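(* Let $\mathcal X,\mathcal Y,\mathcal Z$ be finite sets and $f\colon\mathcal X\times\mathcal Y\to\mathcal Z$ non-constant. Then there exist constants $c,\epsilon_0>0$ depending on $f$ such that for every $0\le\epsilon\le\epsilon_0$, $\mathrm{IC}(f,\epsilon)\le\mathrm{IC}(f,0)-c\,h(\epsilon)$.
   Context: Two-party randomized protocols with public and private randomness; transcript $\Pi$ consists of public randomness and exchanged bits; $\pi(x,y)$ is the output. For $(X,Y)\sim\mu$, $\mathrm{IC}_\mu(\pi)=I(\Pi;X\mid Y)+I(\Pi;Y\mid X)$. A protocol performs $[f,\epsilon]$ if $\Pr[\pi(x,y)\ne f(x,y)]\le\epsilon$ for every input; $\mathrm{IC}_\mu(f,\epsilon)$ is the infimum of $\mathrm{IC}_\mu(\pi)$ over such protocols, and $\mathrm{IC}(f,\epsilon)=\max_\mu\mathrm{IC}_\mu(f,\epsilon)$. $h$ is binary entropy (base 2). *)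

(* Defs.v *)
From mathcomp Require Import all_boot all_order all_algebra.
From mathcomp Require Import all_classical all_reals all_analysis.

Set Implicit Arguments.
Unset Strict Implicit.
Unset Printing Implicit Defensive.

Import Order.TTheory GRing.Theory Num.Theory.

Local Open Scope classical_set_scope.
Local Open Scope ring_scope.

Record fdist (R : realType) (T : finType) := FDist {
  fdist_fun :> {ffun T -> R};
  fdist_ge0 : forall t, 0 <= fdist_fun t;
  fdist_sum1 : \sum_t fdist_fun t = 1 }.

Definition log2 (R : realType) (x : R) : R := ln x / ln 2.

(* [ln 0 = 0] in the library, hence [binary_entropy 0 = binary_entropy 1 = 0]
   as usual. *)
Definition binary_entropy (R : realType) (p : R) : R :=
  - (p * log2 p) - (1 - p) * log2 (1 - p).

Definition Pr (R : realType) (W : finType) (P : W -> R) (E : pred W) : R :=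
  \sum_(w | E w) P w.

(* H(A | C), as the expectation of - log2 p(A | C) over the sample space [W]
   with weights [P].  Sample points of weight 0 contribute 0; at the others the
   numerator and the denominator below are positive. *)
Definition cond_entropy (R : realType) (W : finType) (P : W -> R)
    (TA TC : eqType) (A : W -> TA) (C : W -> TC) : R :=
  - \sum_w P w * log2 (Pr P (fun w' => (A w' == A w) && (C w' == C w)) /
                       Pr P (fun w' => C w' == C w)).

(* I(A ; B | C) = H(A | C) - H(A | B, C) *)
Definition cond_mutual_info (R : realType) (W : finType) (P : W -> R)
    (TA TB TC : eqType) (A : W -> TA) (B : W -> TB) (C : W -> TC) : R :=
  cond_entropy P A C - cond_entropy P A (fun w => (B w, C w)).

(* Deterministic protocol trees.  [A] and [B] are what Alice and Bob see (input
   and private randomness).  At an internal node the speaker sends a bit, which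
   selects the right subtree when it is [true]; a leaf carries the output. *)
Inductive ptree (A B Z : Type) : Type :=
| Leaf of Z
| NodeA of (A -> bool) & ptree A B Z & ptree A B Z
| NodeB of (B -> bool) & ptree A B Z & ptree A B Z.

Fixpoint ptree_bits (A B Z : Type) (t : ptree A B Z) (a : A) (b : B)
    : seq bool :=
  match t with
  | Leaf _ => [::]
  | NodeA m t0 t1 => m a :: ptree_bits (if m a then t1 else t0) a b
  | NodeB m t0 t1 => m b :: ptree_bits (if m b then t1 else t0) a b
  end.

Fixpoint ptree_out (A B Z : Type) (t : ptree A B Z) (a : A) (b : B) : Z :=
  match t with
  | Leaf z => z
  | NodeA m t0 t1 => ptree_out (if m a then t1 else t0) a b
  | NodeB m t0 t1 => ptree_out (if m b then t1 else t0) a b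
  end.

(* The three random strings are independent, range over arbitrary finite sets
   and have arbitrary distributions.  The public one selects the tree. *)
Record protocol (R : realType) (X Y Z : finType) := Protocol {
  pub : finType;
  privA : finType;
  privB : finType;
  pub_dist : fdist R pub;
  privA_dist : fdist R privA;
  privB_dist : fdist R privB;
  tree : pub -> ptree (X * privA) (Y * privB) Z }.

Section Protocols.
Context {R : realType} {X Y Z : finType}.
Implicit Types (pi : protocol R X Y Z) (mu : fdist R (X * Y)%type)
  (f : X -> Y -> Z) (eps : R).

Definition coins pi : finType := (pub pi * privA pi * privB pi)%type.

Definition coins_weight pi (s : coins pi) : R :=
  let: (r, ra, rb) := s in pub_dist pi r * privA_dist pi ra * privB_dist pi rb.

Definition transcript pi (x : X) (y : Y) (s : coins pi) : pub pi * seq bool :=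
  let: (r, ra, rb) := s in (r, ptree_bits (tree r) (x, ra) (y, rb)).

(* It depends on the transcript only: the public randomness and the bits
   determine the leaf that is reached. *)
Definition output pi (x : X) (y : Y) (s : coins pi) : Z :=
  let: (r, ra, rb) := s in ptree_out (tree r) (x, ra) (y, rb).

Definition performs pi f eps : Prop :=
  forall x y,
    Pr (@coins_weight pi) (fun s => output x y s != f x y) <= eps.

Definition IC_protocol mu pi : R :=
  let P (w : X * Y * coins pi) := mu w.1 * coins_weight w.2 in
  let rvX (w : X * Y * coins pi) := w.1.1 in
  let rvY (w : X * Y * coins pi) := w.1.2 in
  let rvPi (w : X * Y * coins pi) := transcript w.1.1 w.1.2 w.2 in
  cond_mutual_info P rvPi rvX rvY + cond_mutual_info P rvPi rvY rvX.

(* For [0 <= eps] this is the infimum of a nonempty set of nonnegative reals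
   (exchanging the inputs computes [f] without error). *)
Definition IC_mu mu f eps : R :=
  inf [set c | exists pi, performs pi f eps /\ c = IC_protocol mu pi].

(* For [0 <= eps] and [X], [Y] nonempty, the set is nonempty and bounded by
   log2 #|X| + log2 #|Y|; the supremum over the compact simplex of
   distributions is the maximum. *)
Definition IC f eps : R :=
  sup [set c | exists mu, c = IC_mu mu f eps].

End Protocols.

(* Main.v *)
(** Take a zero-error protocol and let Alice replace her input X by a uniformly
    random X' with probability eps.  The noisy protocol errs with probability at
    most eps, and on the input distribution mu it costs at most what the original
    one costs on the law mu' of (X', Y), minus I(Pi; X' | X, Y).  As Pi reveals
    f(X', Y), this difference is of order Pr[f(X', Y) <> f(X, Y)] log(1/eps),
    hence of order h(eps) as soon as mu gives non-negligible weight to the columns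
    on which f is not constant; and the original cost is controlled by IC(f, 0)
    whatever mu' is.  By symmetry the same holds for rows.  If on the other hand
    mu is concentrated on pairs of a constant row and a constant column, then
    IC_mu(f, 0) is small, whereas IC(f, 0) >= 1 because f is not constant. *)
Require Import Defs.
From mathcomp Require Import all_boot all_order all_algebra.
From mathcomp Require Import all_classical all_reals all_analysis.
From mathcomp Require Import ring lra.

Set Implicit Arguments.
Unset Strict Implicit.
Unset Printing Implicit Defensive.

Import Order.TTheory GRing.Theory Num.Theory.

Local Open Scope ring_scope.

(** * Entropy *)

Section Logarithm.
Context {R : realType}.
Implicit Types x y : R.

Lemma ln_le_sub1 x : 0 < x -> ln x <= x - 1.
Proof.
move=> x0; have := expR_ge1Dx (ln x); rewrite lnK ?posrE//; lra.
Qed.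

(** The bound [ln x <= x - 1] at [x = 1/2]. It is crude, but the numerical constants further on are
    tuned to it. *)
Lemma ln2_ge_half : 1 / 2 <= ln 2 :> R.
Proof.
have := @ln_le_sub1 (2^-1); rewrite lnV ?posrE//.
have -> : (0 < 2^-1 :> R) by lra.
move=> /(_ isT); lra.
Qed.

Lemma ln2_gt0 : 0 < ln 2 :> R.
Proof. by have := ln2_ge_half; lra. Qed.

Lemma log2_div x y : 0 < x -> 0 < y -> log2 (x / y) = log2 x - log2 y.
Proof.
by move=> x0 y0; rewrite /log2 ln_div ?posrE// mulrBl.
Qed.

Lemma log2_1 : log2 1 = 0 :> R.
Proof. by rewrite /log2 ln1 mul0r. Qed.

Lemma ler_log2 x y : 0 < x -> x <= y -> log2 x <= log2 y.
Proof.
move=> x0 xy; rewrite /log2 ler_wpM2r ?invr_ge0 ?(ltW ln2_gt0)//.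
by rewrite ler_ln ?posrE//; exact: lt_le_trans xy.
Qed.

Lemma log2_le_sub1 x : 0 < x -> log2 x <= (x - 1) / ln 2.
Proof.
by move=> x0; rewrite /log2 ler_wpM2r ?invr_ge0 ?(ltW ln2_gt0)// ln_le_sub1.
Qed.

End Logarithm.

(** * Entropy and mutual information on a finite weighted space *)

Section Entropy.
Context {R : realType} {W : finType} (P : W -> R).
Hypothesis P_ge0 : forall w, 0 <= P w.

(** Unconditional entropy H(A). Conditional entropies and informations are linear combinations of
    such terms, so inequalities between them reduce to [lra]. *)
Definition ent (TA : eqType) (A : W -> TA) : R :=
  - \sum_w P w * log2 (Pr P (fun w' => A w' == A w)).

Lemma Pr_ge0 (E : pred W) : 0 <= Pr P E.
Proof. exact: sumr_ge0. Qed.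

Lemma le_Pr (E F : pred W) :
  (forall w, P w != 0 -> E w -> F w) -> Pr P E <= Pr P F.
Proof.
move=> EF; rewrite /Pr big_mkcond [leRHS]big_mkcond/=; apply: ler_sum => w _.
have [->|Pw] := eqVneq (P w) 0; first by rewrite !if_same.
by case: ifPn => [/(EF _ Pw) ->//|_]; case: ifPn.
Qed.

Lemma Pr_gt0 (E : pred W) w : P w != 0 -> E w -> 0 < Pr P E.
Proof.
move=> Pw Ew; rewrite /Pr (bigD1 w)//= ltr_pwDl ?sumr_ge0//.
by rewrite lt_neqAle eq_sym Pw P_ge0.
Qed.

Lemma ent_congr (TA TB : eqType) (A : W -> TA) (B : W -> TB) :
  (forall w w', (A w == A w') = (B w == B w')) -> ent A = ent B.
Proof.
move=> AB; congr (- _); apply: eq_bigr => w _; congr (_ * log2 _).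
by apply: eq_bigl => w'; exact: AB.
Qed.

Lemma cond_entropyE (TA TC : eqType) (A : W -> TA) (C : W -> TC) :
  cond_entropy P A C = ent (fun w => (A w, C w)) - ent C.
Proof.
rewrite /cond_entropy /ent -opprD -sumrB; congr (- _); apply: eq_bigr => w _.
have [->|Pw] := eqVneq (P w) 0; first by rewrite !mul0r subr0.
rewrite -mulrBr log2_div//; first by apply: (@Pr_gt0 _ w); rewrite ?eqxx.
by apply: (@Pr_gt0 _ w); rewrite ?eqxx.
Qed.

Lemma ent_mono (TA TB : eqType) (A : W -> TA) (B : W -> TB) :
  ent A <= ent (fun w => (B w, A w)).
Proof.
rewrite /ent lerN2; apply: ler_sum => w _.
have [->|Pw] := eqVneq (P w) 0; first by rewrite !mul0r.
rewrite ler_wpM2l// ler_log2//; first by apply: (@Pr_gt0 _ w).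
by apply: le_Pr => w' _ /eqP[_ ->].
Qed.

(** On the support, the fibres of [A] and of (B, A) coincide. The restriction to the support
    matters: a zero-error protocol is only known to be correct on coins of positive weight. *)
Lemma ent_det (TA TB : eqType) (A : W -> TA) (B : W -> TB) :
  (forall w w', P w != 0 -> P w' != 0 -> A w = A w' -> B w = B w') ->
  ent (fun w => (B w, A w)) = ent A.
Proof.
move=> AB; congr (- _); apply: eq_bigr => w _.
have [->|Pw] := eqVneq (P w) 0; first by rewrite !mul0r.
congr (_ * log2 _); rewrite /Pr big_mkcond [RHS]big_mkcond/=.
apply: eq_bigr => w' _; rewrite xpair_eqE.
have [->|Pw'] := eqVneq (P w') 0; first by rewrite !if_same.
by case: (A w' =P A w) => [/(AB _ _ Pw' Pw) ->|]; rewrite ?eqxx ?andbF.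
Qed.

Lemma sum_Pr_le (TA : eqType) (A : W -> TA) (a : TA) :
  \sum_(w | A w == a) P w / Pr P (fun w' => A w' == A w) <= 1.
Proof.
rewrite (eq_bigr (fun w => P w / Pr P (fun w' => A w' == a))); last first.
  by move=> w /eqP ->.
rewrite -mulr_suml -/(Pr P _).
(* A null fibre contributes 0 because division by 0 yields 0; any other fibre gives exactly 1. *)
have [->|h] := eqVneq (Pr P (fun w' => A w' == a)) 0; first by rewrite mul0r.
by rewrite divff.
Qed.

(* Gibbs' inequality: [Q] plays the role of a conditional law of [A] given [C]. *)
Lemma cond_entropy_le (TA TC : eqType) (A : W -> TA) (C : W -> TC) (Q : W -> R) :
  (forall w, P w != 0 -> 0 < Q w) ->
  (forall c, \sum_(w | C w == c)
     Q w * (P w / Pr P (fun w' => (A w' == A w) && (C w' == C w))) <= 1) ->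
  cond_entropy P A C <= - \sum_w P w * log2 (Q w).
Proof.
move=> Q0 Qle; rewrite /cond_entropy lerN2 -subr_le0 -sumrB.
pose pAC w := Pr P (fun w' => (A w' == A w) && (C w' == C w)).
pose pC w := Pr P (fun w' => C w' == C w).
have pos w : P w != 0 -> 0 < pAC w /\ 0 < pC w.
  by move=> Pw; split; apply: (@Pr_gt0 _ w); rewrite //= !eqxx.
apply: (@le_trans _ _ (\sum_w P w * ((Q w / (pAC w / pC w) - 1) / ln 2))).
  apply: ler_sum => w _.
  have [->|Pw] := eqVneq (P w) 0; first by rewrite !mul0r subrr.
  have [h1 h2] := pos _ Pw; have h3 := Q0 _ Pw.
  by rewrite -mulrBr ler_wpM2l// -log2_div ?divr_gt0// log2_le_sub1 ?divr_gt0.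
under eq_bigr do rewrite mulrA mulrBr mulr1.
rewrite -mulr_suml sumrB pmulr_lle0 ?invr_gt0 ?ln2_gt0// subr_le0.
(* Expanding [pC w] as a sum over the fibre of [C] through [w] and exchanging the sums exposes the
   quantity bounded by hypothesis. *)
rewrite (eq_bigr (fun w => \sum_(w' | C w' == C w)
    P w' * (Q w * (P w / pAC w)))); last first.
  by move=> w _; rewrite -mulr_suml -/(Pr P _) -/(pC w) invf_div; ring.
rewrite (exchange_big_dep predT)//=; apply: ler_sum => w' _.
rewrite -mulr_sumr ler_piMr//; under eq_bigl do rewrite eq_sym; exact: Qle.
Qed.

(** Conditioning on more cannot increase entropy: in Gibbs' inequality, [Q] is the law of [A] given
    [C], taken as a guess for its law given (B, C). *)
Lemma ent_submod (TA TB TC : eqType) (A : W -> TA) (B : W -> TB) (C : W -> TC) :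
  ent (fun w => (A w, (B w, C w))) + ent C <=
  ent (fun w => (A w, C w)) + ent (fun w => (B w, C w)).
Proof.
suff : cond_entropy P A (fun w => (B w, C w)) <= cond_entropy P A C.
  by rewrite !cond_entropyE; lra.
apply: cond_entropy_le => [w Pw|[b c]].
  by rewrite divr_gt0//; apply: (@Pr_gt0 _ w); rewrite //= !eqxx.
pose D w := (A w, (B w, C w)).
(* The numerator of [Q] is expanded over [w']. After the exchange the inner sum runs over one fibre
   of [D] and the outer one over one fibre of [C]; [sum_Pr_le] bounds both by 1. *)
rewrite (eq_bigr (fun w => \sum_(w' | (A w' == A w) && (C w' == C w))
    (P w' / Pr P (fun v => C v == c)) *
    (P w / Pr P (fun w' => D w' == D w)))); last first.
  by move=> w /eqP[_ <-]; rewrite -!mulr_suml.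
rewrite (exchange_big_dep (fun w' => C w' == c))/=; last first.
  by move=> i j /eqP[_ ->] /andP[].
apply: le_trans (sum_Pr_le C c).
rewrite [leRHS](eq_bigr (fun w => P w / Pr P (fun v => C v == c))); last first.
  by move=> w /eqP ->.
apply: ler_sum => w' /eqP wc; rewrite -mulr_sumr ler_piMr ?divr_ge0 ?Pr_ge0//.
rewrite (eq_bigl (fun w => D w == (A w', (b, c)))) ?sum_Pr_le// => w.
rewrite !xpair_eqE wc; case: (C w =P c) => [->|]; rewrite ?andbF ?eqxx ?andbT//.
by rewrite andbC eq_sym.
Qed.

(** Gibbs' inequality with one fixed code for [A], the same for every value of [C]; outcome [a] is
    charged [- log2 (q a)]. *)
Lemma cond_entropy_le_weights (TA : finType) (TC : eqType) (A : W -> TA)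
    (C : W -> TC) (q : TA -> R) :
  (forall a, 0 < q a) -> \sum_a q a <= 1 ->
  cond_entropy P A C <= - \sum_w P w * log2 (q (A w)).
Proof.
move=> q0 q1; apply: cond_entropy_le => // c.
rewrite (partition_big A predT)//=; apply: le_trans q1; apply: ler_sum => a _.
rewrite (eq_bigr (fun w => q a *
    (P w / Pr P (fun w' => (A w' == A w) && (C w' == C w))))); last first.
  by move=> w /andP[_ /eqP ->].
rewrite -mulr_sumr ler_piMr ?(ltW (q0 _))//.
rewrite (eq_bigl (fun w => (A w, C w) == (a, c))); last first.
  by move=> w; rewrite xpair_eqE andbC.
exact: (sum_Pr_le (fun w => (A w, C w))).
Qed.

(** At points of [E] the conditional probability of [G] is at most [e], so each contributes at least
    [- log2 e]; elsewhere the contribution is nonnegative. *)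
Lemma cond_entropy_ge (TG TC : eqType) (G : W -> TG) (C : W -> TC) (E : pred W)
    (e : R) :
  (forall w, P w != 0 -> E w ->
     Pr P (fun w' => (G w' == G w) && (C w' == C w)) <=
     e * Pr P (fun w' => C w' == C w)) ->
  Pr P E * - log2 e <= cond_entropy P G C.
Proof.
move=> le_e; rewrite mulrN lerN2 mulr_suml [leRHS]big_mkcond/=; apply: ler_sum => w _.
have [->|Pw] := eqVneq (P w) 0; first by rewrite !mul0r if_same.
have h1 : 0 < Pr P (fun w' => (G w' == G w) && (C w' == C w)).
  by apply: (@Pr_gt0 _ w); rewrite //= !eqxx.
have h2 : 0 < Pr P (fun w' => C w' == C w).
  by apply: (@Pr_gt0 _ w); rewrite //= !eqxx.
case: ifPn => Ew.
  by rewrite ler_wpM2l// ler_log2 ?divr_gt0// ler_pdivrMr// le_e.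
rewrite mulr_ge0_le0// -log2_1 ler_log2 ?divr_gt0// ler_pdivrMr// mul1r.
by apply: le_Pr => w' _ /andP[].
Qed.

Lemma cond_mutual_infoE (TA TB TC : eqType) (A : W -> TA) (B : W -> TB)
    (C : W -> TC) :
  cond_mutual_info P A B C =
  ent (fun w => (A w, C w)) + ent (fun w => (B w, C w))
  - ent (fun w => (A w, (B w, C w))) - ent C.
Proof. by rewrite /cond_mutual_info !cond_entropyE; lra. Qed.

Lemma cond_mutual_info_ge0 (TA TB TC : eqType) (A : W -> TA) (B : W -> TB)
    (C : W -> TC) : 0 <= cond_mutual_info P A B C.
Proof. by rewrite cond_mutual_infoE; have := ent_submod A B C; lra. Qed.

Lemma cond_entropy_ge0 (TA TC : eqType) (A : W -> TA) (C : W -> TC) :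
  0 <= cond_entropy P A C.
Proof. by rewrite cond_entropyE subr_ge0 ent_mono. Qed.

(** Given [C], the variable [G] is a common function of [A] and of [B], hence part of their shared
    information; what remains is I(A; B | G, C), which is nonnegative. *)
Lemma cond_mutual_info_ge (TA TB TC TG : eqType) (A : W -> TA) (B : W -> TB)
    (C : W -> TC) (G : W -> TG) :
  (forall w w', P w != 0 -> P w' != 0 -> A w = A w' -> C w = C w' -> G w = G w') ->
  (forall w w', P w != 0 -> P w' != 0 -> B w = B w' -> C w = C w' -> G w = G w') ->
  cond_entropy P G C <= cond_mutual_info P A B C.
Proof.
move=> AG BG; rewrite cond_mutual_infoE cond_entropyE.
have h1 : ent (fun w => (G w, (A w, C w))) = ent (fun w => (A w, C w)).
  by apply: ent_det => w w' Pw Pw' [? ?]; exact: AG.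
have h2 : ent (fun w => (G w, (B w, C w))) = ent (fun w => (B w, C w)).
  by apply: ent_det => w w' Pw Pw' [? ?]; exact: BG.
have h3 := ent_submod A B (fun w => (G w, C w)).
have h4 := ent_mono (fun w => (A w, (B w, C w))) G.
have h5 : ent (fun w => (A w, (B w, (G w, C w)))) =
          ent (fun w => (G w, (A w, (B w, C w)))).
  by apply: ent_congr => w w'; rewrite !xpair_eqE;
    case: (A w == _); case: (B w == _); case: (G w == _).
have h6 : ent (fun w => (A w, (G w, C w))) = ent (fun w => (G w, (A w, C w))).
  by apply: ent_congr => w w'; rewrite !xpair_eqE; case: (A w == _); case: (G w == _).
have h7 : ent (fun w => (B w, (G w, C w))) = ent (fun w => (G w, (B w, C w))).
  by apply: ent_congr => w w'; rewrite !xpair_eqE; case: (B w == _); case: (G w == _).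
lra.
Qed.

(* [X'] is a noisy version of [X], produced without looking at [Y], and the
   transcript [T] only depends on [X] through [X']. *)
Lemma noise_gain (TT TX TX' TY : eqType) (T : W -> TT) (X : W -> TX)
    (X' : W -> TX') (Y : W -> TY) :
  cond_entropy P T (fun w => (X w, (X' w, Y w))) =
    cond_entropy P T (fun w => (X' w, Y w)) ->
  cond_entropy P X' (fun w => (Y w, X w)) = cond_entropy P X' X ->
  cond_mutual_info P T X Y + cond_mutual_info P T Y X +
    cond_mutual_info P T X' (fun w => (X w, Y w)) <=
  cond_mutual_info P T X' Y + cond_mutual_info P T Y X'.
Proof.
rewrite !cond_mutual_infoE !cond_entropyE => h1 h2.
have c1 : ent (fun w => (T w, (X' w, (X w, Y w)))) =
          ent (fun w => (T w, (X w, (X' w, Y w)))).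
  by apply: ent_congr => w w'; rewrite !xpair_eqE; case: (X' w == _); case: (X w == _).
have c2 : ent (fun w => (X' w, (X w, Y w))) = ent (fun w => (X w, (X' w, Y w))).
  by apply: ent_congr => w w'; rewrite !xpair_eqE; case: (X' w == _); case: (X w == _).
have c3 : ent (fun w => (X' w, (Y w, X w))) = ent (fun w => (X w, (X' w, Y w))).
  apply: ent_congr => w w'; rewrite !xpair_eqE.
  by case: (X' w == _); case: (X w == _); case: (Y w == _).
have c4 : ent (fun w => (T w, (Y w, X w))) = ent (fun w => (T w, (X w, Y w))).
  by apply: ent_congr => w w'; rewrite !xpair_eqE; case: (Y w == _); case: (X w == _).
have c5 : ent (fun w => (T w, (Y w, X' w))) = ent (fun w => (T w, (X' w, Y w))).
  by apply: ent_congr => w w'; rewrite !xpair_eqE; case: (Y w == _); case: (X' w == _).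
have c6 : ent (fun w => (Y w, X w)) = ent (fun w => (X w, Y w)).
  by apply: ent_congr => w w'; rewrite !xpair_eqE andbC.
have c7 : ent (fun w => (Y w, X' w)) = ent (fun w => (X' w, Y w)).
  by apply: ent_congr => w w'; rewrite !xpair_eqE andbC.
(* I(T; Y | X) <= I(T; Y | X X') <= I(T; Y | X') *)
have s1 := ent_submod X' Y (fun w => (T w, X w)).
have s2 := ent_submod T X X'.
have c8 : ent (fun w => (X' w, (Y w, (T w, X w)))) =
          ent (fun w => (T w, (X w, (X' w, Y w)))).
  apply: ent_congr => w w'; rewrite !xpair_eqE.
  by case: (X' w == _); case: (X w == _); case: (Y w == _); case: (T w == _).
have c9 : ent (fun w => (X' w, (T w, X w))) = ent (fun w => (T w, (X w, X' w))).
  apply: ent_congr => w w'; rewrite !xpair_eqE.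
  by case: (X' w == _); case: (X w == _); case: (T w == _).
have c10 : ent (fun w => (Y w, (T w, X w))) = ent (fun w => (T w, (X w, Y w))).
  apply: ent_congr => w w'; rewrite !xpair_eqE.
  by case: (Y w == _); case: (X w == _); case: (T w == _).
have c11 : ent (fun w => (X' w, X w)) = ent (fun w => (X w, X' w)).
  by apply: ent_congr => w w'; rewrite !xpair_eqE andbC.
lra.
Qed.

End Entropy.

(** * Invariance of entropies under change of sample space *)

Section Pushforward.
Context {R : realType} {W V : finType} (P : W -> R) (Q : V -> R) (phi : W -> V).
Hypothesis push : forall v, Q v = \sum_(w | phi w == v) P w.

Lemma sum_push (F : V -> R) : \sum_v Q v * F v = \sum_w P w * F (phi w).
Proof.
rewrite [RHS](partition_big phi predT)//=; apply: eq_bigr => v _.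
by rewrite push mulr_suml; apply: eq_bigr => w /eqP ->.
Qed.

Lemma Pr_push (E : pred V) : Pr Q E = Pr P (fun w => E (phi w)).
Proof.
have h : forall (T : finType) (S : T -> R) (D : pred T),
    Pr S D = \sum_t S t * (D t)%:R.
  by move=> T S D; rewrite /Pr big_mkcond; apply: eq_bigr => t _;
    case: (D t); rewrite ?mulr1 ?mulr0.
by rewrite !h sum_push.
Qed.

Lemma cond_entropy_push (TA TC : eqType) (A : V -> TA) (C : V -> TC) :
  cond_entropy Q A C = cond_entropy P (fun w => A (phi w)) (fun w => C (phi w)).
Proof.
rewrite /cond_entropy sum_push; congr (- _); apply: eq_bigr => w _.
by rewrite !Pr_push.
Qed.

Lemma cond_mutual_info_push (TA TB TC : eqType) (A : V -> TA) (B : V -> TB)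
    (C : V -> TC) :
  cond_mutual_info Q A B C =
  cond_mutual_info P (fun w => A (phi w)) (fun w => B (phi w))
                     (fun w => C (phi w)).
Proof. by rewrite /cond_mutual_info !cond_entropy_push. Qed.

End Pushforward.

Lemma push_bij (R : realType) (W V : finType) (P : W -> R) (Q : V -> R)
    (phi : W -> V) (psi : V -> W) :
  cancel phi psi -> cancel psi phi -> (forall w, Q (phi w) = P w) ->
  forall v, Q v = \sum_(w | phi w == v) P w.
Proof.
move=> phiK psiK QP v; rewrite (big_pred1 (psi v)) => [|w].
  by rewrite -QP psiK.
by rewrite -[in LHS](psiK v) (can_eq phiK).
Qed.

(** * Independent coordinates and Markov conditions *)

Section Product.
Context {R : realType} {U V : finType} (m : U -> R) (k : V -> R).
Hypotheses (m_ge0 : forall u, 0 <= m u) (k_ge0 : forall v, 0 <= k v).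

Definition prod_weight (w : U * V) : R := m w.1 * k w.2.

Lemma prod_weight_ge0 w : 0 <= prod_weight w.
Proof. by rewrite mulr_ge0. Qed.

Lemma sum_prod_weight : \sum_w prod_weight w = (\sum_u m u) * \sum_v k v.
Proof.
rewrite big_distrl/= -(pair_big predT predT (fun u v => m u * k v))/=.
by apply: eq_bigr => u _; rewrite big_distrr.
Qed.

Lemma Pr_prod (E : pred U) (F : pred V) :
  Pr prod_weight (fun w => E w.1 && F w.2) = Pr m E * Pr k F.
Proof.
rewrite /Pr big_distrl/= -(pair_big E F (fun u v => m u * k v))/=.
by apply: eq_bigr => u _; rewrite big_distrr.
Qed.

Hypothesis k_sum1 : \sum_v k v = 1.

Lemma push_fst u : m u = \sum_(w | w.1 == u) prod_weight w.
Proof.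
have := Pr_prod (pred1 u) predT.
rewrite [Pr m _]big_pred1_eq [Pr k _]k_sum1 mulr1 => <-.
by apply: eq_bigl => w /=; rewrite andbT.
Qed.

Lemma Pr_fst (E : pred U) : Pr prod_weight (fun w => E w.1) = Pr m E.
Proof. by rewrite [RHS](Pr_push push_fst). Qed.

(** Once [C] is known, only the independent coordinate [v] is random. The right-hand side does not
    mention [C'], so all refinements of [C] give the same conditional entropy. *)
Lemma cond_entropy_kernel (TA TC TC' : eqType) (C : U -> TC) (C' : U -> TC')
    (F : TC -> V -> TA) :
  (forall u u', C' u = C' u' -> C u = C u') ->
  cond_entropy prod_weight (fun w => F (C w.1) w.2) (fun w => C' w.1) =
  - \sum_w prod_weight w *
      log2 (Pr k (fun v => F (C w.1) v == F (C w.1) w.2)).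
Proof.
move=> CC; congr (- _); apply: eq_bigr => -[u v] _ /=.
have [->|mk] := eqVneq (prod_weight (u, v)) 0; first by rewrite !mul0r.
have mu : m u != 0 by apply: contra_neq mk; rewrite /prod_weight/= => ->; rewrite mul0r.
rewrite (Pr_fst (fun u' => C' u' == C' u)).
have -> : Pr prod_weight (fun w' => (F (C w'.1) w'.2 == F (C u) v) &&
      (C' w'.1 == C' u)) =
    Pr prod_weight (fun w' => (C' w'.1 == C' u) && (F (C u) w'.2 == F (C u) v)).
  apply: eq_bigl => w'; rewrite andbC.
  by case: (C' w'.1 =P C' u) => // /CC ->.
rewrite (Pr_prod (fun u' => C' u' == C' u) (fun v' => F (C u) v' == F (C u) v)).
rewrite [X in log2 X]mulrAC divff ?mul1r//.
have := Pr_gt0 m_ge0 (E := fun u' => C' u' == C' u) mu (eqxx _).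
by case: ltgtP.
Qed.

(** The Markov condition in the shape required by [noise_gain]. *)
Lemma cond_entropy_indep (TA TC TD : eqType) (C : U -> TC) (D : U -> TD)
    (F : TC -> V -> TA) :
  cond_entropy prod_weight (fun w => F (C w.1) w.2) (fun w => (D w.1, C w.1)) =
  cond_entropy prod_weight (fun w => F (C w.1) w.2) (fun w => C w.1).
Proof.
rewrite (@cond_entropy_kernel _ _ _ C (fun u => (D u, C u)) F).
  by rewrite (@cond_entropy_kernel _ _ _ C C F).
by move=> u u' [].
Qed.

End Product.

Section FiniteDistributions.
Context {R : realType}.

Definition mk_fdist (T : finType) (p : T -> R) (p_ge0 : forall t, 0 <= p t)
    (p_sum1 : \sum_t p t = 1) : fdist R T.
Proof.
exists [ffun t => p t] => [t|]; first by rewrite ffunE.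
by under eq_bigr do rewrite ffunE.
Defined.

Lemma mk_fdistE (T : finType) (p : T -> R) p_ge0 p_sum1 t :
  @mk_fdist T p p_ge0 p_sum1 t = p t.
Proof. by rewrite /mk_fdist/= ffunE. Qed.

Lemma fdist_prod_sum1 (S T : finType) (p : fdist R S) (q : fdist R T) :
  \sum_w prod_weight p q w = 1.
Proof. by rewrite sum_prod_weight !fdist_sum1 mulr1. Qed.

Definition fdist_prod (S T : finType) (p : fdist R S) (q : fdist R T) :
    fdist R (S * T)%type :=
  mk_fdist (prod_weight_ge0 (fdist_ge0 p) (fdist_ge0 q)) (fdist_prod_sum1 p q).

Lemma fdist_prodE (S T : finType) (p : fdist R S) (q : fdist R T) w :
  fdist_prod p q w = p w.1 * q w.2.
Proof. exact: mk_fdistE. Qed.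

Lemma fdist_push_ge0 (S T : finType) (p : fdist R S) (g : S -> T) t :
  0 <= \sum_(s | g s == t) p s.
Proof. by apply: sumr_ge0 => s _; exact: fdist_ge0. Qed.

Lemma fdist_push_sum1 (S T : finType) (p : fdist R S) (g : S -> T) :
  \sum_t \sum_(s | g s == t) p s = 1.
Proof. by rewrite -(fdist_sum1 p) [RHS](partition_big g predT). Qed.

Definition fdist_push (S T : finType) (p : fdist R S) (g : S -> T) : fdist R T :=
  mk_fdist (fdist_push_ge0 p g) (fdist_push_sum1 p g).

Lemma fdist_pushE (S T : finType) (p : fdist R S) (g : S -> T) t :
  fdist_push p g t = \sum_(s | g s == t) p s.
Proof. exact: mk_fdistE. Qed.

Definition fdist_dirac (T : finType) (t : T) : fdist R T.
Proof.
apply: (@mk_fdist T (fun s => (s == t)%:R)) => [s|]; first exact: ler0n.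
by rewrite (bigD1 t)//= eqxx big1 ?addr0// => s /negPf ->.
Defined.

End FiniteDistributions.

(** * Protocols *)

Section Trees.
Context {A A' B B' Z : Type}.

Fixpoint ptree_map (g : A' -> A) (h : B' -> B) (t : ptree A B Z) : ptree A' B' Z :=
  match t with
  | Leaf z => Leaf _ _ z
  | NodeA m t0 t1 => NodeA (fun a => m (g a)) (ptree_map g h t0) (ptree_map g h t1)
  | NodeB m t0 t1 => NodeB (fun b => m (h b)) (ptree_map g h t0) (ptree_map g h t1)
  end.

Lemma ptree_bits_map g h t a b :
  ptree_bits (ptree_map g h t) a b = ptree_bits t (g a) (h b).
Proof. by elim: t => //= m t0 IH0 t1 IH1; case: ifP; rewrite ?IH0 ?IH1. Qed.

Lemma ptree_out_map g h t a b :
  ptree_out (ptree_map g h t) a b = ptree_out t (g a) (h b).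
Proof. by elim: t => //= m t0 IH0 t1 IH1; case: ifP; rewrite ?IH0 ?IH1. Qed.

Fixpoint ptree_swap (t : ptree A B Z) : ptree B A Z :=
  match t with
  | Leaf z => Leaf _ _ z
  | NodeA m t0 t1 => NodeB m (ptree_swap t0) (ptree_swap t1)
  | NodeB m t0 t1 => NodeA m (ptree_swap t0) (ptree_swap t1)
  end.

Lemma ptree_bits_swap t a b : ptree_bits (ptree_swap t) b a = ptree_bits t a b.
Proof. by elim: t => //= m t0 IH0 t1 IH1; case: ifP; rewrite ?IH0 ?IH1. Qed.

Lemma ptree_out_swap t a b : ptree_out (ptree_swap t) b a = ptree_out t a b.
Proof. by elim: t => //= m t0 IH0 t1 IH1; case: ifP; rewrite ?IH0 ?IH1. Qed.

(** Each bit selects the next subtree regardless of its sender, so equal bit strings follow the same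
    path to the same leaf. *)
Lemma ptree_bits_out (t : ptree A B Z) a b a' b' :
  ptree_bits t a b = ptree_bits t a' b' -> ptree_out t a b = ptree_out t a' b'.
Proof.
by elim: t => //= m t0 IH0 t1 IH1 [<-]; case: ifP => _; [apply: IH1 | apply: IH0
  | apply: IH1 | apply: IH0].
Qed.

End Trees.

Section Exchange.
Context {A B : finType} {Z : Type}.

(** Alice scans a list of candidates and announces at each whether it is her value; [d] is reached
    only when none of them is. *)
Fixpoint ask_A (s : seq A) (F : A -> ptree A B Z) (d : ptree A B Z) :=
  if s is a :: s' then NodeA (pred1 a) (ask_A s' F d) (F a) else d.

Fixpoint ask_B (s : seq B) (F : B -> ptree A B Z) (d : ptree A B Z) :=
  if s is b :: s' then NodeB (pred1 b) (ask_B s' F d) (F b) else d.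

Lemma ask_A_out s F d a b : a \in s ->
  ptree_out (ask_A s F d) a b = ptree_out (F a) a b.
Proof.
by elim: s => //= a' s IH; rewrite inE; case: eqVneq => [->|_ /IH].
Qed.

Lemma ask_B_out s F d a b : b \in s ->
  ptree_out (ask_B s F d) a b = ptree_out (F b) a b.
Proof.
by elim: s => //= b' s IH; rewrite inE; case: eqVneq => [->|_ /IH].
Qed.

Definition exchange_tree (o : A -> B -> Z) (z : Z) : ptree A B Z :=
  ask_A (enum A) (fun a => ask_B (enum B) (fun b => Leaf A B (o a b)) (Leaf _ _ z))
    (Leaf _ _ z).

Lemma exchange_tree_out o z a b : ptree_out (exchange_tree o z) a b = o a b.
Proof. by rewrite /exchange_tree ask_A_out ?mem_enum// ask_B_out ?mem_enum. Qed.

End Exchange.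

Section ProtocolBasics.
Context {R : realType} {X Y Z : finType}.
Implicit Types (pi : protocol R X Y Z) (mu : fdist R (X * Y)%type)
  (f : X -> Y -> Z) (eps : R).

Lemma coins_weight_ge0 pi (s : coins pi) : 0 <= coins_weight s.
Proof. by case: s => -[r ra] rb; rewrite /= !mulr_ge0// fdist_ge0. Qed.

Lemma coins_weight_sum1 pi : \sum_(s : coins pi) coins_weight s = 1.
Proof.
rewrite -(fdist_sum1 (fdist_prod (fdist_prod (pub_dist pi) (privA_dist pi))
  (privB_dist pi))).
by apply: eq_bigr => -[[r ra] rb] _; rewrite !fdist_prodE.
Qed.

Lemma transcript_output pi x y s x' y' s' :
  transcript (pi := pi) x y s = transcript x' y' s' ->
  output x y s = output x' y' s'.
Proof.
case: s s' => -[r ra] rb [[r' ra'] rb'] [<-] /=.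
exact: ptree_bits_out.
Qed.

Lemma performs0_output pi f x y (s : coins pi) :
  performs pi f 0 -> coins_weight s != 0 -> output x y s = f x y.
Proof.
move=> /(_ x y) err s0; apply/eqP; apply: contraTT err => out.
by rewrite -ltNge (Pr_gt0 (@coins_weight_ge0 pi) s0 out).
Qed.

Lemma performs_le pi f eps eps' : eps <= eps' -> performs pi f eps -> performs pi f eps'.
Proof. by move=> le_eps h x y; exact: le_trans (h x y) le_eps. Qed.

Lemma IC_protocol_ge0 mu pi : 0 <= IC_protocol mu pi.
Proof.
have P0 (w : X * Y * coins pi) : 0 <= mu w.1 * coins_weight w.2.
  by rewrite mulr_ge0 ?fdist_ge0 ?coins_weight_ge0.
by rewrite /IC_protocol addr_ge0// cond_mutual_info_ge0.
Qed.

Lemma IC_mu_le mu f eps pi : performs pi f eps ->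
  IC_mu mu f eps <= IC_protocol mu pi.
Proof.
move=> h; apply: ge_inf; last by exists pi.
by exists 0 => _ [pi' [_ ->]]; exact: IC_protocol_ge0.
Qed.

Lemma le_IC_mu mu f eps (b : R) : (exists pi, performs pi f eps) ->
  (forall pi, performs pi f eps -> b <= IC_protocol mu pi) ->
  b <= IC_mu mu f eps.
Proof.
move=> [pi h] le_b; apply: lb_le_inf; first by exists (IC_protocol mu pi); exists pi.
by move=> _ [pi' [h' ->]]; exact: le_b.
Qed.

End ProtocolBasics.

(** * Exchanging the roles of Alice and Bob *)

Section Swap.
Context {R : realType} {X Y Z : finType}.
Implicit Types (pi : protocol R X Y Z) (f : X -> Y -> Z).

Definition protocol_swap pi : protocol R Y X Z :=
  Protocol (pub_dist pi) (privB_dist pi) (privA_dist pi)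
    (fun r => ptree_swap (tree r)).

Definition coins_swap pi (s : coins pi) : coins (protocol_swap pi) :=
  (s.1.1, s.2, s.1.2).

Definition coins_unswap pi (s : coins (protocol_swap pi)) : coins pi :=
  (s.1.1, s.2, s.1.2).

Lemma coins_swapK pi : cancel (@coins_swap pi) (@coins_unswap pi).
Proof. by case=> -[]. Qed.

Lemma coins_unswapK pi : cancel (@coins_unswap pi) (@coins_swap pi).
Proof. by case=> -[]. Qed.

Lemma coins_weight_swap pi (s : coins pi) :
  coins_weight (coins_swap s) = coins_weight s.
Proof. by case: s => -[r ra] rb /=; rewrite mulrAC. Qed.

Lemma output_swap pi x y (s : coins pi) :
  output y x (coins_swap s) = output x y s.
Proof. by case: s => -[r ra] rb /=; exact: ptree_out_swap. Qed.

Lemma transcript_swap pi x y (s : coins pi) :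
  transcript y x (coins_swap s) = transcript x y s.
Proof. by case: s => -[r ra] rb /=; congr pair; exact: ptree_bits_swap. Qed.

Lemma performs_swap pi f eps :
  performs pi f eps -> performs (protocol_swap pi) (fun y x => f x y) eps.
Proof.
move=> h y x.
rewrite (Pr_push (push_bij (@coins_swapK pi) (@coins_unswapK pi)
  (@coins_weight_swap pi))).
apply: le_trans (h x y); rewrite /Pr le_eqVlt; apply/orP; left; apply/eqP.
by apply: eq_bigl => s; rewrite output_swap.
Qed.

Lemma IC_protocol_swap (mu : fdist R (X * Y)%type) (nu : fdist R (Y * X)%type) pi :
  (forall x y, nu (y, x) = mu (x, y)) ->
  IC_protocol nu (protocol_swap pi) = IC_protocol mu pi.
Proof.
move=> numu; rewrite /IC_protocol addrC.
pose phi (w : X * Y * coins pi) : Y * X * coins (protocol_swap pi) :=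
  (w.1.2, w.1.1, coins_swap w.2).
pose psi (w : Y * X * coins (protocol_swap pi)) : X * Y * coins pi :=
  (w.1.2, w.1.1, coins_unswap w.2).
pose P (w : X * Y * coins pi) := mu w.1 * coins_weight w.2.
pose Q (w : Y * X * coins (protocol_swap pi)) := nu w.1 * coins_weight w.2.
have push : forall v, Q v = \sum_(w | phi w == v) P w.
  apply: (@push_bij _ _ _ _ _ phi psi) => [||w].
  - by case=> -[x y] s; rewrite /phi /psi coins_swapK.
  - by case=> -[x y] s; rewrite /phi /psi coins_unswapK.
  - case: w => -[x y] s; congr (_ * _); first exact: numu.
    exact: coins_weight_swap.
have TE : (fun w => transcript (phi w).1.1 (phi w).1.2 (phi w).2) =
    (fun w => transcript w.1.1 w.1.2 w.2).
  by apply/funext => -[[x y] s]; exact: transcript_swap.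
have pushI (TB TC : eqType) (B : X * Y * coins pi -> TB)
    (C : X * Y * coins pi -> TC) B' C' :
    (fun w => B' (phi w)) = B -> (fun w => C' (phi w)) = C ->
    cond_mutual_info Q (fun w => transcript w.1.1 w.1.2 w.2) B' C' =
    cond_mutual_info P (fun w => transcript w.1.1 w.1.2 w.2) B C.
  by move=> <- <-; rewrite (cond_mutual_info_push push) TE.
by congr (_ + _); exact: pushI.
Qed.

End Swap.

(** * Protocols that exchange coarsened inputs *)

Section Exchange.
Context {R : realType} {X Y Z A B : finType}.
Implicit Types (f : X -> Y -> Z).

(** The parties reveal only [g x] and [h y]. All coins are trivial, and [z] merely labels leaves
    that are never reached. *)
Definition exchange_protocol (g : X -> A) (h : Y -> B) (o : A -> B -> Z) (z : Z)
    : protocol R X Y Z :=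
  Protocol (fdist_dirac tt) (fdist_dirac tt) (fdist_dirac tt)
    (fun=> ptree_map (fun a => g a.1) (fun b => h b.1) (exchange_tree o z)).

Lemma exchange_protocol_performs g h o z f :
  (forall x y, o (g x) (h y) = f x y) -> performs (exchange_protocol g h o z) f 0.
Proof.
move=> of_ x y; rewrite /Pr big_pred0// => -[[r ra] rb] /=.
by rewrite ptree_out_map exchange_tree_out of_ eqxx.
Qed.

(** The transcript is a function of the revealed pair, so each of the two information terms is at
    most the cost of encoding that pair with the weights [q]; hence the factor 2. *)
Lemma IC_exchange_protocol_le (mu : fdist R (X * Y)%type) g h o z (q : A * B -> R) :
  (forall c, 0 < q c) -> \sum_c q c <= 1 ->
  IC_protocol mu (exchange_protocol g h o z) <=
  2 * - \sum_w mu w * log2 (q (g w.1, h w.2)).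
Proof.
move=> q0 q1; set pi := exchange_protocol _ _ _ _.
pose P (w : X * Y * coins pi) : R := mu w.1 * coins_weight w.2.
have P0 w : 0 <= P w by rewrite mulr_ge0 ?fdist_ge0 ?coins_weight_ge0.
pose M (w : X * Y * coins pi) := (g w.1.1, h w.1.2).
have -> : \sum_w mu w * log2 (q (g w.1, h w.2)) = \sum_w P w * log2 (q (M w)).
  have := @sum_push _ _ _ P mu fst
    (push_fst mu (coins_weight_sum1 pi)).
  by move=> ->.
have key (TC TD : eqType) (C : X * Y * coins pi -> TC) (D : X * Y * coins pi -> TD) :
    cond_mutual_info P (fun w => transcript w.1.1 w.1.2 w.2) D C <=
    - \sum_w P w * log2 (q (M w)).
  rewrite /cond_mutual_info.
  have := cond_entropy_ge0 P0 (fun w => transcript w.1.1 w.1.2 w.2)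
    (fun w => (D w, C w)).
  have := cond_entropy_le_weights P0 M C q0 q1.
  suff : cond_entropy P (fun w => transcript w.1.1 w.1.2 w.2) C <=
         cond_entropy P M C by lra.
  rewrite !cond_entropyE// lerD2r.
  rewrite -(@ent_det _ _ P _ _ (fun w => (M w, C w))
    (fun w => transcript w.1.1 w.1.2 w.2)); last first.
    move=> [[x y] [[[] ra] rb]] [[x' y'] [[[] ra'] rb']] _ _ [gx hy _] /=.
    by rewrite !ptree_bits_map /= gx hy.
  apply: le_trans (ent_mono P0 _ M) _.
  rewrite le_eqVlt; apply/orP; left; apply/eqP; apply: ent_congr => w w'.
  by rewrite !xpair_eqE; case: (C w == _); case: (g _ == _); case: (h _ == _);
    rewrite ?andbF ?andbT.
have := key _ _ (fun w => w.1.2) (fun w => w.1.1).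
have := key _ _ (fun w => w.1.1) (fun w => w.1.2).
rewrite /IC_protocol -/P; lra.
Qed.

End Exchange.

Lemma sum_option (R : realType) (T : finType) (F : option T -> R) :
  \sum_n F n = F None + \sum_t F (Some t).
Proof.
rewrite (bigD1 None)//=; congr (_ + _).
rewrite (reindex_omap Some id) => [|[]//].
by apply: eq_bigl => t /=; rewrite eqxx.
Qed.

(** * Input noise and its effect on a zero-error protocol *)

Section NoiseDistribution.
Context {R : realType} {X : finType} (eps : R).

(** [None] keeps the input and [Some x'] replaces it by [x']. The replacement may equal the true
    input. *)
Definition noise_weight (n : option X) : R :=
  if n is Some _ then eps / #|X|%:R else 1 - eps.

Hypotheses (eps01 : 0 <= eps <= 1) (X0 : (0 < #|X|)%N).

Lemma noise_weight_ge0 n : 0 <= noise_weight n.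
Proof.
by case/andP: eps01 => e0 e1; case: n => [x|] /=; rewrite ?divr_ge0// subr_ge0.
Qed.

Lemma noise_weight_Some : \sum_x noise_weight (Some x) = eps.
Proof.
by rewrite /= sumr_const -[RHS]mulr1 -mulrnAr -[_ *+ _]mulr_natr mulVf// pnatr_eq0 -lt0n.
Qed.

Lemma noise_weight_sum1 : \sum_n noise_weight n = 1.
Proof. by rewrite sum_option noise_weight_Some /=; lra. Qed.

Definition noise : fdist R (option X) := mk_fdist noise_weight_ge0 noise_weight_sum1.

Lemma noiseE n : noise n = noise_weight n.
Proof. exact: mk_fdistE. Qed.

Lemma Pr_noise_Some : Pr noise (fun n => n != None) = eps.
Proof.
rewrite /Pr big_mkcond sum_option /= add0r -[RHS]noise_weight_Some.
by apply: eq_bigr => x _; rewrite noiseE.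
Qed.

End NoiseDistribution.

Section NoisyProtocol.
Context {R : realType} {X Y Z : finType} (pi : protocol R X Y Z) (eps : R).
Hypotheses (eps01 : 0 <= eps <= 1) (X0 : (0 < #|X|)%N).

Let nu := noise eps01 X0.

(** The noise is a component of Alice's private coins, so it is not itself recorded in the
    transcript. *)
Definition noisy_protocol : protocol R X Y Z :=
  Protocol (pub_dist pi) (fdist_prod (privA_dist pi) nu) (privB_dist pi)
    (fun r => ptree_map (fun a => (odflt a.1 a.2.2, a.2.1)) id (tree r)).

Definition add_noise (w : option X * coins pi) : coins noisy_protocol :=
  (w.2.1.1, (w.2.1.2, w.1), w.2.2).

Definition split_noise (s : coins noisy_protocol) : option X * coins pi :=
  (s.1.2.2, (s.1.1, s.1.2.1, s.2)).

Lemma add_noiseK : cancel add_noise split_noise.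
Proof. by case=> n [[]]. Qed.

Lemma split_noiseK : cancel split_noise add_noise.
Proof. by case=> -[r []]. Qed.

Lemma coins_weight_add_noise w :
  coins_weight (add_noise w) = nu w.1 * coins_weight w.2.
Proof. by case: w => n [[r ra] rb] /=; rewrite ffunE /prod_weight/=; ring. Qed.

Lemma output_add_noise x y w :
  output x y (add_noise w) = output (odflt x w.1) y w.2.
Proof. by case: w => n [[r ra] rb] /=; rewrite ptree_out_map. Qed.

Lemma transcript_add_noise x y w :
  transcript x y (add_noise w) = transcript (odflt x w.1) y w.2.
Proof. by case: w => n [[r ra] rb] /=; rewrite ptree_bits_map. Qed.

(** An error on coins of positive weight forces the noise to differ from [None], an event of
    probability [eps]. *)
Lemma noisy_protocol_performs f : performs pi f 0 -> performs noisy_protocol f eps.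
Proof.
move=> pi0 x y.
rewrite (Pr_push (push_bij add_noiseK split_noiseK coins_weight_add_noise)).
rewrite -[leRHS](Pr_noise_Some eps01 X0).
rewrite -(Pr_fst nu (coins_weight_sum1 pi) (fun n => n != None)).
apply: le_Pr => [w|[n s] ws]; first by apply: prod_weight_ge0 => ?; rewrite ?fdist_ge0 ?coins_weight_ge0.
rewrite output_add_noise; apply: contraNneq => /= ->.
rewrite (performs0_output _ _ pi0)//; apply: contraNneq ws => /= ->.
by rewrite /prod_weight/= mulr0.
Qed.

Section Gain.
Variables (f : X -> Y -> Z) (mu : fdist R (X * Y)%type).
Hypothesis pi0 : performs pi f 0.

(** Common sample space: the noisy protocol on [mu] and the original protocol on [noisy_input] are
    both pushforwards of [P]. *)
Let m : X * Y * option X -> R := prod_weight mu nu.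
Let P : X * Y * option X * coins pi -> R :=
  prod_weight m (@coins_weight R X Y Z pi).
Let m_ge0 u : 0 <= m u. Proof. exact: prod_weight_ge0 (fdist_ge0 _) (fdist_ge0 _) u. Qed.
Let P_ge0 w : 0 <= P w.
Proof. exact: prod_weight_ge0 m_ge0 (@coins_weight_ge0 _ _ _ _ pi) w. Qed.

Let inX (u : X * Y * option X) := u.1.1.
Let inX' (u : X * Y * option X) := odflt u.1.1 u.2.
Let inY (u : X * Y * option X) := u.1.2.
Let T (w : X * Y * option X * coins pi) := transcript (inX' w.1) (inY w.1) w.2.

Definition noisy_input : fdist R (X * Y)%type :=
  fdist_push (fdist_prod mu nu) (fun u => (odflt u.1.1 u.2, u.1.2)).

Lemma IC_noisy_protocolE :
  IC_protocol mu noisy_protocol =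
  cond_mutual_info P T (fun w => inX w.1) (fun w => inY w.1) +
  cond_mutual_info P T (fun w => inY w.1) (fun w => inX w.1).
Proof.
pose Q (w : X * Y * coins noisy_protocol) : R := mu w.1 * coins_weight w.2.
pose phi (w : X * Y * option X * coins pi) : X * Y * coins noisy_protocol :=
  (w.1.1, add_noise (w.1.2, w.2)).
pose psi (w : X * Y * coins noisy_protocol) : X * Y * option X * coins pi :=
  ((w.1, (split_noise w.2).1), (split_noise w.2).2).
have push : forall v, Q v = \sum_(w | phi w == v) P w.
  apply: (@push_bij _ _ _ _ _ phi psi) => [||w].
  - by case=> -[[x y] n] [[]].
  - by case=> -[x y] [[r []]].
  - rewrite /Q [coins_weight _]coins_weight_add_noise /P /m /prod_weight /=.
    by rewrite mulrA.
have TE : (fun w => transcript (phi w).1.1 (phi w).1.2 (phi w).2) = T.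
  by apply/funext => w; exact: transcript_add_noise.
by congr (_ + _); rewrite (cond_mutual_info_push push) TE.
Qed.

Lemma IC_noisy_inputE :
  IC_protocol noisy_input pi =
  cond_mutual_info P T (fun w => inX' w.1) (fun w => inY w.1) +
  cond_mutual_info P T (fun w => inY w.1) (fun w => inX' w.1).
Proof.
pose Q (w : X * Y * coins pi) : R := noisy_input w.1 * coins_weight w.2.
pose phi (w : X * Y * option X * coins pi) : X * Y * coins pi :=
  ((inX' w.1, inY w.1), w.2).
have push : forall v, Q v = \sum_(w | phi w == v) P w.
  move=> [z s]; have := Pr_prod m (@coins_weight R X Y Z pi)
    (fun u => (inX' u, inY u) == z) (pred1 s).
  rewrite [X in _ = _ * X]big_pred1_eq => h.
  rewrite (eq_bigl (fun w => ((inX' w.1, inY w.1) == z) && pred1 s w.2)) => [|w].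
    rewrite [RHS]h /Q fdist_pushE; congr (_ * _); apply: eq_bigr => u _.
    exact: fdist_prodE.
  by rewrite xpair_eqE.
by congr (_ + _); rewrite (cond_mutual_info_push push).
Qed.

(** The two Markov conditions behind [noise_gain]: T depends on X only through (X', Y) and the
    coins, and X' is made from X and noise independent of Y. *)
Lemma noisy_protocol_independence :
  cond_mutual_info P T (fun w => inX w.1) (fun w => inY w.1) +
  cond_mutual_info P T (fun w => inY w.1) (fun w => inX w.1) +
  cond_mutual_info P T (fun w => inX' w.1) (fun w => (inX w.1, inY w.1)) <=
  cond_mutual_info P T (fun w => inX' w.1) (fun w => inY w.1) +
  cond_mutual_info P T (fun w => inY w.1) (fun w => inX' w.1).
Proof.
apply: noise_gain => //.
  exact: (cond_entropy_indep m_ge0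
    (coins_weight_sum1 pi) (fun u => (inX' u, inY u)) inX
    (fun c s => transcript c.1 c.2 s)).
have push := push_fst m (coins_weight_sum1 pi).
rewrite -(cond_entropy_push push inX' (fun u => (inY u, inX u))).
rewrite -(cond_entropy_push push inX' inX).
exact: (cond_entropy_indep (fdist_ge0 mu) (fdist_sum1 nu) fst snd
  (fun x n => odflt x n)).
Qed.

Let changed (u : X * Y * option X) := f (inX' u) (inY u) != f (inX u) (inY u).

(** Given (X, Y), the event [changed] can be read off X', and also off T, which reveals f(X', Y) as
    there is no error. Its conditional probability is at most [eps], so its entropy gives the
    bound. *)
Lemma noisy_protocol_info :
  Pr m changed * - log2 eps <=
  cond_mutual_info P T (fun w => inX' w.1) (fun w => (inX w.1, inY w.1)).
Proof.
have fT w : P w != 0 -> f (inX' w.1) (inY w.1) = output (inX' w.1) (inY w.1) w.2.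
  move=> Pw; rewrite (performs0_output _ _ pi0)//; apply: contraNneq Pw => w0.
  by rewrite /P /prod_weight w0 mulr0.
apply: le_trans (cond_mutual_info_ge P_ge0 (G := fun w => changed w.1) _ _); last first.
- by move=> w w' _ _ hX' [hX hY]; rewrite /changed hX' hX hY.
- move=> w w' Pw Pw' hT [hX hY]; rewrite /changed !fT//.
  by rewrite (transcript_output hT) hX hY.
rewrite -(Pr_fst m (coins_weight_sum1 pi) changed).
apply: (cond_entropy_ge P_ge0) => w Pw chw; rewrite chw.
rewrite (Pr_fst m (coins_weight_sum1 pi)
  (fun u => (changed u == true) && ((inX u, inY u) == (inX w.1, inY w.1)))).
rewrite (Pr_fst m (coins_weight_sum1 pi)
  (fun u => (inX u, inY u) == (inX w.1, inY w.1))).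
rewrite (Pr_fst mu (fdist_sum1 nu)
  (fun u => (u.1, u.2) == (inX w.1, inY w.1))).
rewrite mulrC -[X in _ * X](Pr_noise_Some eps01 X0) -Pr_prod.
apply: (le_Pr m_ge0) => -[[x y] n] _ /=; rewrite eqb_id andbC => /andP[->] /=.
(* With noise [None] one has X' = X, so [changed] fails. *)
by rewrite /changed /inX'; case: n => //=; rewrite eqxx.
Qed.

(** A single witness [x'] suffices: the noise hits it with probability [eps / #|X|]. *)
Lemma Pr_changed_ge :
  Pr mu (fun xy => [exists x', f x' xy.2 != f xy.1 xy.2]) * (eps / #|X|%:R) <=
  Pr m changed.
Proof.
rewrite /Pr mulr_suml.
rewrite [leRHS]big_mkcond -(pair_big predT predT
  (fun xy n => if changed (xy, n) then m (xy, n) else 0))/=.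
have ge0 xy n : 0 <= (if changed (xy, n) then m (xy, n) else 0) by case: ifP.
rewrite [leLHS]big_mkcond; apply: ler_sum => xy _; case: ifPn => [/existsP[x' hx']|_].
  rewrite (bigD1 (Some x'))//= {1}/changed /inX' /= hx' {1}/m /prod_weight noiseE/=.
  by rewrite lerDl sumr_ge0.
by rewrite sumr_ge0.
Qed.

Lemma IC_noisy_protocol_le (delta : R) :
  delta <= Pr mu (fun xy => [exists x', f x' xy.2 != f xy.1 xy.2]) ->
  IC_protocol mu noisy_protocol <=
  IC_protocol noisy_input pi - delta * (eps / #|X|%:R) * - log2 eps.
Proof.
move=> le_delta; rewrite IC_noisy_protocolE IC_noisy_inputE.
have := noisy_protocol_independence.
suff : delta * (eps / #|X|%:R) * - log2 eps <=
    cond_mutual_info P T (fun w => inX' w.1) (fun w => (inX w.1, inY w.1)) by lra.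
apply: le_trans noisy_protocol_info.
case/andP: eps01 => e0 e1; apply: ler_wpM2r.
  (* At [eps = 0] the convention [ln 0 = 0] keeps the sign. *)
  rewrite oppr_ge0; move: e0; rewrite le_eqVlt => /orP[/eqP<-|e0].
    by rewrite /log2 ln0// mul0r.
  by rewrite -log2_1 ler_log2.
apply: le_trans Pr_changed_ge; apply: ler_wpM2r => //; exact: divr_ge0.
Qed.

End Gain.
End NoisyProtocol.

(** * Information complexity *)

Section BinaryEntropy.
Context {R : realType}.
Implicit Types p : R.

Lemma log2V p : 0 < p -> log2 p^-1 = - log2 p.
Proof. by move=> p0; rewrite /log2 lnV ?posrE// mulNr. Qed.

Lemma log2_half : log2 (1 / 2) = -1 :> R.
Proof. by rewrite div1r log2V// /log2 divff// gt_eqF// ln2_gt0. Qed.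

Lemma mul_log2_le p : 0 <= p <= 1 -> p * - log2 p <= 1 / ln 2.
Proof.
case/andP => p0 p1; have l2 := @ln2_gt0 R.
move: p0; rewrite le_eqVlt => /orP[/eqP<-|p0].
  by rewrite mul0r divr_ge0// ltW.
rewrite -log2V//; apply: (@le_trans _ _ (p * ((p^-1 - 1) / ln 2))).
  by rewrite ler_wpM2l ?(ltW p0)// log2_le_sub1// invr_gt0.
rewrite mulrA mulrBr divff ?gt_eqF// ler_pM2r ?invr_gt0//; lra.
Qed.

(** The second term of the entropy is at most [p / ln 2]. For [p <= 1/4], [- ln p >= 2 * ln 2 >= 1],
    so the first term dominates it. *)
Lemma binary_entropy_le p : 0 <= p <= 1 / 4 ->
  binary_entropy p <= 2 * (p * - log2 p).
Proof.
case/andP => p0 p4; have l2 := @ln2_gt0 R; have l2' := @ln2_ge_half R.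
move: p0; rewrite le_eqVlt => /orP[/eqP<-|p0].
  by rewrite /binary_entropy !mul0r subr0 log2_1; lra.
have h1 : (1 - p) * - log2 (1 - p) <= p / ln 2.
  have q0 : 0 < 1 - p by lra.
  rewrite -log2V//; apply: (@le_trans _ _ ((1 - p) * (((1 - p)^-1 - 1) / ln 2))).
    by rewrite ler_wpM2l ?(ltW q0)// log2_le_sub1// invr_gt0.
  rewrite mulrA mulrBr divff ?gt_eqF// ler_pM2r ?invr_gt0//; lra.
have h2 : (ln 2)^-1 <= - log2 p.
  rewrite /log2 -mulNr -[leLHS]mul1r ler_pM2r ?invr_gt0//.
  have : ln p <= ln (2^-1 * 2^-1) by rewrite ler_ln ?posrE//; lra.
  by rewrite lnM ?posrE// lnV ?posrE//; lra.
have h3 : p / ln 2 <= p * - log2 p by rewrite ler_pM2l.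
rewrite /binary_entropy; lra.
Qed.

End BinaryEntropy.

(** * Bounds on information complexity *)

Section InformationComplexity.
Context {R : realType} {X Y Z : finType}.
Implicit Types (f : X -> Y -> Z) (mu : fdist R (X * Y)%type).

Lemma exists_performs0 f (z : Z) : exists pi : protocol R X Y Z, performs pi f 0.
Proof. by exists (exchange_protocol id id f z); exact: exchange_protocol_performs. Qed.

Lemma IC_mu_le_IC mu f (z : Z) : IC_mu mu f 0 <= IC (R := R) f 0.
Proof.
apply: ub_le_sup; last by exists mu.
pose N : R := #|{: X * Y}|%:R.
(* The supremum needs an upper bound: exchanging the inputs, coded uniformly, costs at most twice
   [log2 N], whatever the distribution. *)
exists (2 * - \sum_(c : X * Y) mu c * log2 N^-1) => _ [nu ->].
have perf : performs (exchange_protocol (R := R) (X := X) (Y := Y) id id f z) f 0.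
  exact: exchange_protocol_performs.
apply: le_trans (IC_mu_le nu perf) _.
have [N0|N0] := posnP #|{: X * Y}|.
  have := fdist_sum1 nu; rewrite big_pred0 => [/eqP|c].
    by rewrite eq_sym oner_eq0.
  by have := card0_eq N0 c; rewrite inE.
have Np : 0 < N by rewrite ltr0n.
have := IC_exchange_protocol_le nu id id f z (q := fun=> N^-1).
rewrite -!mulr_suml !fdist_sum1; apply => [_|]; first by rewrite invr_gt0.
by rewrite sumr_const -[_ *+ _]mulr_natl divff ?gt_eqF.
Qed.

Lemma IC_le f eps (b : R) (x : X) (y : Y) :
  (forall mu, IC_mu mu f eps <= b) -> IC f eps <= b.
Proof.
move=> le_b; apply: ge_sup; first by exists (IC_mu (fdist_dirac (x, y)) f eps), (fdist_dirac (x, y)).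
by move=> _ [mu ->].
Qed.

Lemma fair_coin_sum1 : \sum_(b : bool) (1 / 2) = 1 :> R.
Proof. by rewrite big_bool /= -splitr. Qed.

Lemma fair_coin_ge0 (b : bool) : 0 <= 1 / 2 :> R.
Proof. by rewrite divr_ge0. Qed.

Definition two_points (p q : X * Y) : fdist R (X * Y)%type :=
  fdist_push (mk_fdist fair_coin_ge0 fair_coin_sum1) (fun b => if b then p else q).

(** Given the shared coordinate, the value of f is a fair bit, which a zero-error transcript must
    reveal; one of the two information terms is therefore at least 1. *)
Lemma IC_two_points f (p q : X * Y) (pi : protocol R X Y Z) :
  f p.1 p.2 <> f q.1 q.2 -> p.1 = q.1 \/ p.2 = q.2 -> performs pi f 0 ->
  1 <= IC_protocol (two_points p q) pi.
Proof.
move=> fpq pq pi0; set mu := two_points p q.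
pose P (w : X * Y * coins pi) : R := mu w.1 * coins_weight w.2.
have P0 w : 0 <= P w by rewrite mulr_ge0 ?fdist_ge0 ?coins_weight_ge0.
pose G (w : X * Y * coins pi) := f w.1.1 w.1.2.
have entG (TC : eqType) (C : X * Y -> TC) : C p = C q ->
    1 <= cond_entropy P G (fun w => C w.1).
  move=> Cpq; have /= := cond_entropy_ge P0 (G := G) (C := fun w => C w.1)
    (E := predT) (e := 1 / 2).
  rewrite log2_half opprK mulr1 (Pr_fst mu (coins_weight_sum1 pi) predT).
  rewrite [Pr mu _]fdist_sum1; apply => w _ _.
  rewrite (Pr_fst mu (coins_weight_sum1 pi)
    (fun xy => (f xy.1 xy.2 == G w) && (C xy == C w.1))).
  rewrite (Pr_fst mu (coins_weight_sum1 pi) (fun xy => C xy == C w.1)).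
  rewrite !(Pr_push (fdist_pushE _ _)) /Pr.
  rewrite big_mkcond [X in _ <= _ * X]big_mkcond !big_bool /= !ffunE Cpq.
  case: (C q == C w.1); rewrite ?andbF ?andbT /=; last lra.
  case: eqP => [<-|_]; last by case: ifP => _; lra.
  by case: eqP => [/esym/fpq//|_]; lra.
have fT w : P w != 0 -> G w = output w.1.1 w.1.2 w.2.
  move=> Pw; rewrite (performs0_output _ _ pi0)//; apply: contraNneq Pw => w0.
  by rewrite /P w0 mulr0.
have infoG (TB TC : eqType) (B : X * Y -> TB) (C : X * Y -> TC) :
    (forall a b, B a = B b -> C a = C b -> a = b) -> C p = C q ->
    1 <= cond_mutual_info P (fun w => transcript w.1.1 w.1.2 w.2)
           (fun w => B w.1) (fun w => C w.1).
  move=> BC /entG Cpq; apply: le_trans Cpq _; apply: cond_mutual_info_ge => //.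
    by move=> w w' Pw Pw' hT _; rewrite !fT// (transcript_output hT).
  by move=> w w' _ _ hB hC; rewrite /G (BC _ _ hB hC).
rewrite /IC_protocol -/P.
case: pq => pq.
  have := infoG _ _ snd fst; rewrite pq => h.
  apply: le_trans (h _ erefl) _ => [[a b] [a' b'] /= -> -> //|].
  by rewrite lerDr cond_mutual_info_ge0.
have := infoG _ _ fst snd; rewrite pq => h.
apply: le_trans (h _ erefl) _ => [[a b] [a' b'] /= -> -> //|].
by rewrite lerDl cond_mutual_info_ge0.
Qed.

Lemma IC_ge1 f x y x' y' : f x y <> f x' y' -> 1 <= IC (R := R) f 0.
Proof.
move=> fxy.
have [p [q [fpq pq]]] : exists p q : X * Y,
    f p.1 p.2 <> f q.1 q.2 /\ (p.1 = q.1 \/ p.2 = q.2).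
  (* On the path from (x, y) through (x', y) to (x', y'), f changes along at least one leg. *)
  have [e|e] := eqVneq (f x y) (f x' y).
    by exists (x', y), (x', y'); split; [rewrite /= -e | left].
  by exists (x, y), (x', y); split; [exact/eqP | right].
apply: le_trans (IC_mu_le_IC (two_points p q) f (f x y)).
apply: le_IC_mu => [|pi]; first exact: exists_performs0 (f x y).
exact: IC_two_points.
Qed.

Lemma fdist_push_swap mu x y :
  fdist_push mu (fun xy => (xy.2, xy.1)) (y, x) = mu (x, y).
Proof.
rewrite fdist_pushE (big_pred1 (x, y))// => -[a b] /=.
by rewrite !xpair_eqE andbC.
Qed.

(** The gain does not depend on the protocol, so the infimum over zero-error protocols on
    [noisy_input] can be taken, and it is at most IC(f, 0). *)
Lemma IC_mu_noise_A mu f (z : Z) (delta eps : R) : 0 <= eps <= 1 ->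
  delta <= Pr mu (fun xy => [exists x', f x' xy.2 != f xy.1 xy.2]) ->
  IC_mu mu f eps <= IC f 0 - delta * (eps / #|X|%:R) * - log2 eps.
Proof.
move=> eps01 le_delta.
have X0 : (0 < #|X|)%N.
  rewrite lt0n; apply/eqP => X0; have := fdist_sum1 mu.
  rewrite big_pred0 => [/eqP|-[a b]]; first by rewrite eq_sym oner_eq0.
  by have := card0_eq X0 a; rewrite inE.
rewrite lerBrDr; apply: le_trans (IC_mu_le_IC (noisy_input eps01 X0 mu) f z).
apply: le_IC_mu => [|pi pi0]; first exact: exists_performs0 z.
have := IC_mu_le mu (noisy_protocol_performs eps01 X0 pi0).
have := IC_noisy_protocol_le eps01 X0 pi0 le_delta; lra.
Qed.

End InformationComplexity.

Section Swapped.
Context {R : realType} {X Y Z : finType}.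
Implicit Types (f : X -> Y -> Z) (mu : fdist R (X * Y)%type).

Lemma IC_mu_swap_le mu (nu : fdist R (Y * X)%type) f eps (z : Z) : 0 <= eps ->
  (forall x y, nu (y, x) = mu (x, y)) ->
  IC_mu nu (fun y x => f x y) eps <= IC_mu mu f eps.
Proof.
move=> eps0 numu; apply: le_IC_mu => [|pi pif].
  have [pi pi0] := @exists_performs0 R _ _ _ f z.
  by exists pi; exact: performs_le pi0.
rewrite -(IC_protocol_swap pi numu).
exact: (IC_mu_le nu (performs_swap pif)).
Qed.

End Swapped.

Section NoiseForBob.
Context {R : realType} {X Y Z : finType}.
Implicit Types (f : X -> Y -> Z) (mu : fdist R (X * Y)%type).

Lemma IC_swap_le f (x : X) (y : Y) (z : Z) :
  IC (R := R) (fun y x => f x y) 0 <= IC f 0.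
Proof.
apply: (IC_le y x) => nu.
pose mu := fdist_push nu (fun yx => (yx.2, yx.1)).
apply: le_trans (IC_mu_le_IC mu f z).
by apply: IC_mu_swap_le => // a b; rewrite fdist_push_swap.
Qed.

Lemma IC_mu_noise_B mu f (x : X) (y : Y) (z : Z) (delta eps : R) : 0 <= eps <= 1 ->
  delta <= Pr mu (fun xy => [exists y', f xy.1 y' != f xy.1 xy.2]) ->
  IC_mu mu f eps <= IC f 0 - delta * (eps / #|Y|%:R) * - log2 eps.
Proof.
move=> eps01 le_delta.
pose nu := fdist_push mu (fun xy => (xy.2, xy.1)).
have eps0 : 0 <= eps by case/andP: eps01.
apply: (@le_trans _ _ (IC_mu nu (fun y x => f x y) eps)).
  apply: (@IC_mu_swap_le _ _ _ _ nu mu (fun y x => f x y) _ z) => // b a.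
  by rewrite /nu fdist_push_swap.
apply: (@le_trans _ _ (IC (fun y x => f x y) 0 -
    delta * (eps / #|Y|%:R) * - log2 eps)); last first.
  by rewrite lerD2r IC_swap_le.
apply: (IC_mu_noise_A _ eps01) => //.
by rewrite (Pr_push (fdist_pushE _ _)).
Qed.

End NoiseForBob.

(** * Distributions concentrated on constant rows and columns *)

Section ConstantLines.
Context {R : realType} {X Y Z : finType} (f : X -> Y -> Z).

Let const_row x := [forall y, [forall y', f x y == f x y']].
Let const_col y := [forall x, [forall x', f x y == f x' y]].

Let const_rowP x y y' : const_row x -> f x y = f x y'.
Proof. by move=> /forallP/(_ y)/forallP/(_ y')/eqP. Qed.

Let const_colP x x' y : const_col y -> f x y = f x' y.
Proof. by move=> /forallP/(_ x)/forallP/(_ x')/eqP. Qed.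

Let nonconst_row x y : ~~ const_row x -> [exists y', f x y' != f x y].
Proof.
apply: contraR => /existsPn h; apply/forallP => y1; apply/forallP => y2.
by have /negPn/eqP -> := h y1; have /negPn/eqP -> := h y2.
Qed.

Let nonconst_col x y : ~~ const_col y -> [exists x', f x' y != f x y].
Proof.
apply: contraR => /existsPn h; apply/forallP => x1; apply/forallP => x2.
by have /negPn/eqP -> := h x1; have /negPn/eqP -> := h x2.
Qed.

Let N : R := #|{: option X * option Y}|%:R.

Let N_ge1 : 1 <= N.
Proof. by rewrite ler1n card_prod !card_option. Qed.

(** The silent outcome is made cheap, as [16/15 - 1 = 1/15], while any other costs at most
    [16 * N / ln 2]. *)
Let q (c : option X * option Y) : R :=
  if c == (None, None) then 15 / 16 else 1 / (16 * N).

Let q_gt0 c : 0 < q c.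
Proof. by have := N_ge1; rewrite /q; case: ifP => _ h; rewrite divr_gt0//; lra. Qed.

Let q_sum : \sum_c q c <= 1.
Proof.
have h := N_ge1; rewrite (bigD1 (None, None))//= /q eqxx.
apply: (@le_trans _ _ (15 / 16 + \sum_(c : option X * option Y) 1 / (16 * N))).
  rewrite lerD2l big_mkcond; apply: ler_sum => c _.
  by case: eqP => //= _; rewrite divr_ge0//; lra.
have -> : \sum_(c : option X * option Y) 1 / (16 * N) = 1 / 16.
  by rewrite sumr_const -[LHS]mulr_natl -/N; field; lra.
lra.
Qed.

(* Each party reveals its input only when its row or column is not constant;
   Gibbs' inequality is applied with the weights [q]. *)
Lemma IC_mu_constant_lines (mu : fdist R (X * Y)%type) :
  Pr mu (fun xy => [exists y', f xy.1 y' != f xy.1 xy.2]) <= 1 / (480 * N) ->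
  Pr mu (fun xy => [exists x', f x' xy.2 != f xy.1 xy.2]) <= 1 / (480 * N) ->
  IC_mu mu f 0 <= 4 / 15 / ln 2.
Proof.
move=> hrow hcol; have h := N_ge1; have l2 := @ln2_gt0 R.
have mu0 := @fdist_ge0 _ _ mu.
pose bad xy := ~~ const_row xy.1 || ~~ const_col xy.2.
have hbad : Pr mu bad <= 2 * (1 / (480 * N)).
  apply: (@le_trans _ _ (Pr mu (fun xy => [exists y', f xy.1 y' != f xy.1 xy.2]) +
      Pr mu (fun xy => [exists x', f x' xy.2 != f xy.1 xy.2]))); last lra.
  rewrite /Pr big_mkcond [X in _ <= X + _]big_mkcond [X in _ <= _ + X]big_mkcond.
  rewrite -big_split; apply: ler_sum => xy _ /=.
  have m0 := mu0 xy; rewrite /bad.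
  case: (boolP (const_row xy.1)) => /= [_|/nonconst_row ->]; last first.
    by case: ifP => _; lra.
  case: (boolP (const_col xy.2)) => /= [_|/nonconst_col ->].
    by do 2 case: ifP => _; lra.
  by case: ifP => _; lra.
have hsmall : 2 * (1 / (480 * N)) <= 1 / 240.
  have -> : 2 * (1 / (480 * N)) = 1 / 240 / N by field; lra.
  by rewrite ler_pdivrMr; lra.
(* Not every pair is bad, since bad pairs weigh at most 1/240. The constant row [xa] and constant
   column [yb] obtained here serve to decode [None]. *)
have [[xa yb] /= /norP[/negPn ra /negPn cb]] : exists xy, ~~ bad xy.
  apply: contrapT => /forallNP all_bad; have := fdist_sum1 mu.
  rewrite (eq_bigl bad) => [|xy]; first by rewrite -/(Pr mu bad); lra.
  by have /negP/negPn -> := all_bad xy.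
pose g x := if const_row x then None else Some x.
pose k y := if const_col y then None else Some y.
have perf : performs (exchange_protocol (R := R) g k
    (fun a b => f (odflt xa a) (odflt yb b)) (f xa yb)) f 0.
  apply: exchange_protocol_performs => x y; rewrite /g /k.
  have [rx|_] := boolP (const_row x) => /=.
    rewrite (const_rowP _ yb ra) (const_rowP y yb rx).
    exact: const_colP.
  have [cy|//] := boolP (const_col y) => /=.
  rewrite (const_colP x xa cb) (const_rowP yb y ra).
  exact: const_colP.
apply: le_trans (IC_mu_le mu perf) _.
apply: le_trans (IC_exchange_protocol_le mu g k _ _ q_gt0 q_sum) _.
suff : - \sum_w mu w * log2 (q (g w.1, k w.2)) <= 2 / 15 / ln 2 by lra.
(* The constant 480 balances the budget: the silent outcome and the bad pairs each account for at
   most [1 / 15 / ln 2]. *)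
have -> : 2 / 15 / ln 2 = (1 / 15) / ln 2 + 2 * (1 / (480 * N)) * (16 * N / ln 2) :> R.
  by field; lra.
apply: (@le_trans _ _ (\sum_w (mu w * (1 / 15 / ln 2) +
    (if bad w then mu w else 0) * (16 * N / ln 2)))); last first.
  rewrite big_split -!mulr_suml fdist_sum1 mul1r lerD2l ler_wpM2r//.
    by rewrite divr_ge0 ?(ltW l2)//; lra.
  by rewrite -big_mkcond.
rewrite -sumrN; apply: ler_sum => xy _; have m0 := mu0 xy.
have lnb (a b : R) : 0 < a -> a^-1 - 1 <= b -> - log2 a <= b / ln 2.
  move=> a0 ab; rewrite -log2V//; apply: le_trans (log2_le_sub1 _) _.
    by rewrite invr_gt0.
  by rewrite ler_pM2r ?invr_gt0.
rewrite -mulrN; case: ifPn => [_|/norP[/negPn rx /negPn cy]]; last first.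
  rewrite mul0r addr0 ler_wpM2l// /q /g /k rx cy eqxx lnb//; lra.
apply: (@le_trans _ _ (mu xy * (16 * N / ln 2))); last first.
  by rewrite lerDr mulr_ge0// !divr_ge0// ltW.
rewrite ler_wpM2l// lnb ?q_gt0// /q; case: ifP => _; rewrite invf_div; lra.
Qed.

End ConstantLines.

(** * Choice of constants and case analysis on the input distribution *)

Theorem mainTheorem13 (R : realType) (X Y Z : finType) (f : X -> Y -> Z)
  (f_nonconst : exists x y x' y', f x y <> f x' y') :
  exists c eps0 : R, 0 < c /\ 0 < eps0 /\
    forall eps : R, 0 <= eps <= eps0 ->
      IC f eps <= IC f 0 - c * binary_entropy eps.
Proof.
have [x [y [x' [y' fxy]]]] := f_nonconst.
pose N : R := #|{: option X * option Y}|%:R.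
pose delta : R := 1 / (480 * N).
have X0 : (0 < #|X|)%N by apply/card_gt0P; exists x.
have Y0 : (0 < #|Y|)%N by apply/card_gt0P; exists y.
have NX : #|X|%:R <= N.
  by rewrite ler_nat card_prod !card_option (leq_trans (leqnSn _))// leq_pmulr.
have NY : #|Y|%:R <= N.
  by rewrite ler_nat card_prod !card_option (leq_trans (leqnSn _))// leq_pmull.
have X1 : 1 <= #|X|%:R :> R by rewrite ler1n.
have Y1 : 1 <= #|Y|%:R :> R by rewrite ler1n.
have delta0 : 0 < delta by rewrite divr_gt0//; lra.
have l2 := @ln2_gt0 R; have l2' := @ln2_ge_half R.
(* [N] dominates both [#|X|] and [#|Y|], so one constant serves both parties; the 2 and the 1/4 come
   from [binary_entropy_le]. *)
exists (delta / (2 * N)), (1 / 4); split; first by rewrite divr_gt0//; lra.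
split=> [|eps /andP[e0 e4]]; first lra.
have eps01 : 0 <= eps <= 1 by apply/andP; lra.
have L0 : 0 <= eps * - log2 eps.
  move: e0; rewrite le_eqVlt => /orP[/eqP<-|e0]; first by rewrite mul0r.
  by rewrite mulr_ge0 ?(ltW e0)// oppr_ge0 -log2_1 ler_log2//; lra.
have he : binary_entropy eps <= 2 * (eps * - log2 eps).
  by apply: binary_entropy_le; rewrite e0.
have c_he : delta / (2 * N) * binary_entropy eps <= delta / N * (eps * - log2 eps).
  apply: (@le_trans _ _ (delta / (2 * N) * (2 * (eps * - log2 eps)))).
    by rewrite ler_wpM2l// divr_ge0//; lra.
  rewrite le_eqVlt; apply/orP; left; apply/eqP; field.
  by rewrite gt_eqF//; lra.
have gain (M : R) : 1 <= M -> M <= N ->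
    delta / (2 * N) * binary_entropy eps <= delta * (eps / M) * - log2 eps.
  move=> M1 MN; apply: le_trans c_he _.
  have -> : delta * (eps / M) * - log2 eps = delta / M * (eps * - log2 eps) by ring.
  by rewrite ler_wpM2r// ler_pM2l// lef_pV2 ?posrE; lra.
apply: (IC_le x y) => mu.
have [hcol|hcol] := leP delta
    (Pr mu (fun xy => [exists x', f x' xy.2 != f xy.1 xy.2])).
  have := IC_mu_noise_A (f x y) eps01 hcol; have := gain _ X1 NX; lra.
have [hrow|hrow] := leP delta
    (Pr mu (fun xy => [exists y', f xy.1 y' != f xy.1 xy.2])).
  have := IC_mu_noise_B x y (f x y) eps01 hrow; have := gain _ Y1 NY; lra.
(* In the remaining case the noiseless protocol already suffices, as it also meets the weaker error
   bound [eps]. *)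
have h0 : IC_mu mu f eps <= 4 / 15 / ln 2.
  apply: le_trans (IC_mu_constant_lines (ltW hrow) (ltW hcol)).
  apply: le_IC_mu => [|pi pi0]; first exact: exists_performs0 (f x y).
  exact: IC_mu_le (performs_le e0 pi0).
have h1 := IC_ge1 (R := R) fxy.
(* The fraction 7/30 is what is left: [4/15 + 7/30 = 1/2 <= ln 2], so cost plus gain stay below 1,
   hence below IC(f, 0). *)
have h2 : delta / N * (eps * - log2 eps) <= 7 / 30 / ln 2.
  have dN : delta / N <= 7 / 30.
    rewrite ler_pdivrMr; last lra.
    rewrite /delta ler_pdivrMr; nra.
  apply: (@le_trans _ _ (7 / 30 * (1 / ln 2))); last by rewrite mulrA mulr1.
  apply: ler_pM => //; first by rewrite divr_ge0//; lra.
  exact: mul_log2_le.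
have h3 : 4 / 15 / ln 2 + 7 / 30 / ln 2 <= 1 :> R.
  by rewrite -mulrDl ler_pdivrMr// mul1r; lra.
lra.
Qed.
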